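(* Let $\tau$ be a $\Lambda$-acceptable sequence, and let $B\subset\mathcal{D}_\tau$ be nonempty. Then $B$ is closed and internally chain transitive (for the shift map $\sigma:\mathcal{D}_\tau\to\mathcal{D}_\tau$) if and only if $B=\omega(z)$ for some $z\in\mathcal{D}_\tau$.
   Context: Let $\omega=\{0,1,2,\dots\}$. Give $\{0,1,*\}$ the non-Hausdorff topology with basis $\{\{0\},\{1\},\{0,1,*\}\}$, and let $\Lambda=\{0,1,*\}^\omega$ with the product topology. Let $\sigma$ be the shift map, $\sigma(x_0x_1x_2\dots)=x_1x_2\dots$. A sequence $\tau=\tau_0\tau_1\dots\in\Lambda$ is $\Lambda$-acceptable if: (1) for all $n\in\omega$, $\tau_n=*$ if and only if $\sigma^{n+1}(\tau)=\tau$; and (2) for all $n\in\omega$ with $\sigma^n(\tau)\neq\tau$ there is $m\in\omega$ such that $*\neq\tau_{m+n}\neq\tau_m\neq *$. Given a $\Lambda$-acceptable $\tau$, a sequence $\alpha\in\Lambda$ is $(\Lambda,\tau)$-consistent if for all $n\in\omega$, $\alpha_n=*$ implies $\sigma^{n+1}(\alpha)=\tau$. It is $(\Lambda,\tau)$-admissible if it is $(\Lambda,\tau)$-consistent and for all $n\in\omega$ with $\sigma^n(\alpha)\neq *\tau$ there is some $m>0$ such that $*\neq\alpha_{m+n}\neq\tau_{m-1}\neq *$. Here $*\tau$ is the sequence $*\tau_0\tau_1\dots$. $\mathcal{D}_\tau$ is the set of all $(\Lambda,\tau)$-admissible sequences, with the subspace topology from $\Lambda$. It is known (Baldwin) that $\mathcal{D}_\tau$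 is a shift-invariant self-similar dendrite (a locally connected, uniquely arcwise connected compact metrizable space). It carries a natural arc-length (taxicab) metric $d$ compatible with this topology; since the space is compact, the notions below do not depend on which compatible metric is used. For a continuous map $f$ on a compact metric space $(X,d)$, a set $M\subseteq X$ is internally chain transitive if for every $\varepsilon>0$ and every $x,y\in M$ there are $n\geq 1$ and points $x=x_0,x_1,\dots,x_n=y$, all in $M$, with $d(f(x_i),x_{i+1})<\varepsilon$ for $0\le i\le n-1$. The $\omega$-limit set of $z\in X$ is $\omega(z)=\bigcap_{n\ge 0}\overline{\{f^k(z):k\ge n\}}$. *)

(* Defs.v *)
From HB Require Import structures.
From mathcomp Require Import all_boot all_order all_algebra.
From mathcomp Require Import all_classical all_reals all_analysis.

Set Implicit Arguments.
Unset Strict Implicit.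
Unset Printing Implicit Defensive.

Local Open Scope classical_set_scope.
Local Open Scope ring_scope.

Inductive symbol := Zero | One | Star.

Definition option_of_symbol (s : symbol) : option bool :=
  match s with Zero => Some false | One => Some true | Star => None end.

Definition symbol_of_option (o : option bool) : symbol :=
  match o with Some false => Zero | Some true => One | None => Star end.

Lemma option_of_symbolK : cancel option_of_symbol symbol_of_option.
Proof. by case. Qed.

HB.instance Definition _ := Finite.copy symbol (can_type option_of_symbolK).

Definition symbol_basis : set (set symbol) :=
  [set [set Zero]; [set One]; setT].

Lemma symbol_basis_cover : \bigcup_(U in symbol_basis) U = setT.
Proof. by rewrite -subTset => s _; exists setT => //; right. Qed.

Lemma symbol_basis_join (U V : set symbol) (s : symbol) :
  symbol_basis U -> symbol_basis V -> U s -> V s ->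
  exists W, [/\ symbol_basis W, W s & W `<=` U `&` V].
Proof.
move=> BU BV Us Vs.
have [UT|nUT] := pselect (U = setT).
  by exists V; split => // t Vt; split => //; rewrite UT.
exists U; split => // t Ut; split => //.
suff -> : t = s by [].
by case: BU Us Ut nUT => [[->|->]|->] //= -> ->.
Qed.

(* The three-point space is not Hausdorff: the only neighbourhood of Star is
   the whole space. *)
HB.instance Definition _ :=
  isBaseTopological.Build symbol symbol_basis_cover symbol_basis_join.

Definition Lambda : topologicalType := {ptws nat -> symbol}.

Definition shift (x : Lambda) : Lambda := fun n => x n.+1.

Definition cons_seq (s : symbol) (x : Lambda) : Lambda :=
  fun n => if n is k.+1 then x k else s.

Definition acceptable (tau : Lambda) : Prop :=
  (forall n, tau n = Star <-> iter n.+1 shift tau = tau) /\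
  (forall n, iter n shift tau <> tau ->
    exists m, [/\ Star <> tau (m + n)%N, tau (m + n)%N <> tau m
                & tau m <> Star]).

Definition consistent (tau alpha : Lambda) : Prop :=
  forall n, alpha n = Star -> iter n.+1 shift alpha = tau.

Definition admissible (tau alpha : Lambda) : Prop :=
  consistent tau alpha /\
  (forall n, iter n shift alpha <> cons_seq Star tau ->
    exists m, [/\ (0 < m)%N, Star <> alpha (m + n)%N,
                  alpha (m + n)%N <> tau m.-1 & tau m.-1 <> Star]).

(* Used as a type, [D tau] is the subtype [set_type (D tau)], which carries the
   subspace topology. *)
Definition D (tau : Lambda) : set Lambda := [set alpha | admissible tau alpha].

Lemma shift_D (tau alpha : Lambda) : D tau alpha -> D tau (shift alpha).
Proof.
move=> [calpha dalpha]; split=> [n an|n].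
  by rewrite -iterSr; exact: calpha.
rewrite -iterSr => /dalpha[m [m0]]; rewrite addnS => h1 h2 h3.
by exists m.
Qed.

Definition shiftD (tau : Lambda) (x : D tau) : D tau :=
  exist _ (shift (set_val x)) (mem_set (shift_D (set_valP x))).

Record is_compatible_metric (R : realType) (T : topologicalType)
    (d : T -> T -> R) : Prop := {
  metric_eq0 : forall x y, d x y = 0 <-> x = y;
  metric_symmetric : forall x y, d x y = d y x;
  metric_le_add : forall x y z, d x z <= d x y + d y z;
  metric_nbhs : forall x,
    nbhs x = filter_from [set e : R | 0 < e] (fun e => [set y | d x y < e])
}.

Definition internally_chain_transitive (R : realType) (T : Type)
    (d : T -> T -> R) (f : T -> T) (M : set T) : Prop :=
  forall eps : R, 0 < eps -> forall x y, M x -> M y ->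
    exists (n : nat) (p : nat -> T),
      [/\ (1 <= n)%N, p 0%N = x, p n = y,
          forall i, (i <= n)%N -> M (p i)
        & forall i, (i < n)%N -> d (f (p i)) (p i.+1) < eps].

Definition omega_limit (T : topologicalType) (f : T -> T) (z : T) : set T :=
  \bigcap_n closure [set iter k f z | k in [set k | (n <= k)%N]].

(* Main.v *)
(* Every point alpha of D tau is determined by any binary sequence completing it
   (one that replaces the stars of alpha by bits), every binary sequence
   completes a point, and that point depends continuously on the sequence: D tau
   is a quotient of the full 2-shift, hence compact. If x_0, x_1, ... is an
   asymptotic pseudo-orbit in D tau, the binary sequence of the leading symbols
   of the x_i completes a point z whose orbit is asymptotic to it. A closed
   internally chain transitive set B is the set of cluster points of such a
   pseudo-orbit, obtained by concatenating finer and finer chains of B between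
   the terms of a sequence clustering at every point of B; so B is the
   omega-limit set of z. The converse holds for every continuous map of a compact
   metric space. *)

Require Import Defs.
From mathcomp Require Import all_boot all_order all_algebra.
From mathcomp Require Import all_classical all_reals all_analysis.

Import Order.TTheory GRing.Theory Num.Theory Defs.

Set Implicit Arguments.
Unset Strict Implicit.
Unset Printing Implicit Defensive.

Local Open Scope classical_set_scope.
Local Open Scope ring_scope.

(** * Shifts and binary completions *)

Lemma iter_shiftE n (x : Lambda) k : iter n shift x k = x (k + n)%N.
Proof. by elim: n k => [|n IH] k; rewrite ?addn0 //= /shift IH addSnnS. Qed.

Lemma iter_shift_cons_eq (tau alpha : Lambda) n :
  iter n shift alpha = cons_seq Star tau <->
  alpha n = Star /\ iter n.+1 shift alpha = tau.
Proof.
split=> [e|[an e]].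
  have h k : alpha (k + n)%N = cons_seq Star tau k by rewrite -iter_shiftE e.
  split; first exact: (h 0%N).
  by apply/funext => k; rewrite iter_shiftE addnS -addSn h.
apply/funext => -[|k]; first by rewrite iter_shiftE.
by rewrite iter_shiftE /= -e iter_shiftE addSnnS.
Qed.

Definition bit (s : symbol) : bool := if s is One then true else false.

Definition symbol_of_bool (b : bool) : symbol := if b then One else Zero.

Lemma bitK s : s <> Star -> symbol_of_bool (bit s) = s.
Proof. by case: s. Qed.

Definition completes (x : nat -> bool) (alpha : nat -> symbol) :=
  forall k, alpha k <> Star -> alpha k = symbol_of_bool (x k).

Lemma completes_bit (alpha : Lambda) : completes (bit \o alpha) alpha.
Proof. by move=> k /bitK /= ->. Qed.

Lemma completes_iter {x : nat -> bool} {alpha : Lambda} n :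
  completes x alpha -> completes (fun k => x (k + n)%N) (iter n shift alpha).
Proof. by move=> xa k; rewrite iter_shiftE; exact: xa. Qed.

Arguments completes_iter {x alpha} n.

Lemma common_completion (alpha beta : nat -> symbol) :
  (forall k, alpha k <> Star -> beta k <> Star -> alpha k = beta k) ->
  exists x, completes x alpha /\ completes x beta.
Proof.
move=> ab.
exists (fun k => if alpha k == Star then bit (beta k) else bit (alpha k)).
split=> k; case: eqP => [a|/[dup] a /bitK -> //] /[dup] b /bitK.
  by rewrite a in b.
  by [].
by move=> _; rewrite (ab _ a b).
Qed.

(** The second clause of acceptability supplies a position where both sequences carry bits and
    differ, which excludes a common completion. *)
Lemma acceptable_eq {tau : Lambda} (htau : acceptable tau) x n :
  completes x (iter n shift tau) -> completes x tau -> iter n shift tau = tau.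
Proof.
move=> xn x0; apply: contrapT => /htau.2[m [s1 ne s0]].
apply: ne; rewrite (x0 m) ?s0// -(xn m) iter_shiftE //.
exact/nesym.
Qed.

(** Same argument with the second clause of admissibility; its [m.-1] accounts for the leading star
    of [cons_seq Star tau]. *)
Lemma admissible_eq {tau alpha : Lambda} (ha : admissible tau alpha) x n :
  completes x (iter n.+1 shift alpha) -> completes x tau ->
  alpha n = Star /\ iter n.+1 shift alpha = tau.
Proof.
move=> xa x0; apply/iter_shift_cons_eq.
apply: contrapT => /ha.2[[|m] [//= _ s1 ne s0]].
apply: ne; rewrite /= (x0 m) ?s0// -(xa m) iter_shiftE addnS//.
exact/nesym.
Qed.

(* The only point of D tau completed by x: a star stands at k exactly when the
   sequence following x k completes tau. *)
Definition itinerary (tau : Lambda) (x : nat -> bool) : Lambda := fun k =>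
  if `[< completes (fun j => x (j + k.+1)%N) tau >] then Star
  else symbol_of_bool (x k).

Lemma completes_itinerary tau x : completes x (itinerary tau x).
Proof. by move=> k; rewrite /itinerary; case: asboolP. Qed.

Lemma iter_shift_itinerary tau x n :
  iter n shift (itinerary tau x) = itinerary tau (fun k => x (k + n)%N).
Proof.
apply/funext => k; rewrite iter_shiftE /itinerary.
suff -> : (fun j => x (j + (k + n).+1)%N) = (fun j => x (j + k.+1 + n)%N) by [].
by apply/funext => j; rewrite -addnA addSn.
Qed.

(** The tail of [y] after [k] always completes [iter k.+1 shift tau], so it completes [tau] exactly
    when these two sequences agree, that is, when [tau k] is a star. *)
Lemma itinerary_eq_tau {tau : Lambda} (htau : acceptable tau) y :
  completes y tau -> itinerary tau y = tau.
Proof.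
move=> ytau; apply/funext => k; rewrite /itinerary.
case: asboolP => [h|nh].
  apply/esym/htau.1.
  exact: (acceptable_eq htau (completes_iter k.+1 ytau) h).
rewrite -ytau // => /htau.1 e; apply: nh.
by rewrite -[X in completes _ X]e; exact: completes_iter.
Qed.

Lemma itinerary_admissible {tau : Lambda} (htau : acceptable tau) x :
  D tau (itinerary tau x).
Proof.
split=> [n|n nstar].
  rewrite iter_shift_itinerary /itinerary; case: asboolP => [h _|_].
    exact: itinerary_eq_tau.
  by case: (x n).
apply: contrapT => nm; apply: nstar; apply/iter_shift_cons_eq.
rewrite iter_shift_itinerary.
set y := (fun k => x (k + n.+1)%N).
(* A position where [itinerary tau y] and [tau] carry different bits would be the missing witness,
   so the two have a common completion [v]. *)
have [k ak tk|v [va vt]] := @common_completion (itinerary tau y) tau.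
  apply: contrapT => ne; apply: nm; exists k.+1.
  have e : itinerary tau x (k.+1 + n)%N = itinerary tau y k.
    by rewrite addSnnS -iter_shiftE iter_shift_itinerary.
  by split; rewrite ?e //; exact/nesym.
suff ytau : completes y tau.
  by split; [rewrite /itinerary asboolT | exact: itinerary_eq_tau].
(* At a star of [itinerary tau y] the tail that follows is [tau]; then the shifted [v] completes
   both [tau] and [iter k.+1 shift tau], which forces [tau k] to be a star. *)
move=> k tk.
have [ak|/eqP ak] := eqVneq (itinerary tau y k) Star; last first.
  by rewrite (vt k tk) -(va k ak) completes_itinerary.
case: tk; apply/htau.1; apply: (acceptable_eq htau (completes_iter k.+1 vt)).
have <- : iter k.+1 shift (itinerary tau y) = tau; last exact: completes_iter.
rewrite iter_shift_itinerary; apply: itinerary_eq_tau => //.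
by move: ak; rewrite /itinerary; case: asboolP => // _; case: (y k).
Qed.

(** Since [alpha n] is a bit, the tail of [x] after [n] contradicts [tau] at some [m]. The first
    [m + n + 2] bits record this contradiction, so they exclude a star at [n] for every [beta] they
    complete. *)
Lemma completes_local {tau : Lambda} {alpha : Lambda} x n :
  D tau alpha -> completes x alpha -> alpha n <> Star ->
  exists N, forall (y : nat -> bool) (beta : Lambda),
    (forall k, (k < N)%N -> y k = x k) -> D tau beta -> completes y beta ->
    beta n = alpha n.
Proof.
move=> Da xa an.
have [m [tm xm]] : exists m,
    tau m <> Star /\ tau m <> symbol_of_bool (x (m + n.+1)%N).
  apply: contrapT => nm; apply: an.
  apply: (admissible_eq Da (completes_iter n.+1 xa) _).1 => m tm.
  by apply: contrapT => xm; apply: nm; exists m.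
exists (m + n.+2)%N => y beta yx Db yb.
have [bn|/eqP bn] := eqVneq (beta n) Star; last first.
  by rewrite (yb n bn) (xa n an) yx // addnS ltnS addnS leqW // leq_addl.
case: xm; rewrite -yx ?addnS // -addnS.
have := completes_iter n.+1 yb; rewrite (Db.1 n bn) => /(_ m tm) -> //.
Qed.

(** * Ultrafilters and coordinatewise convergence *)

Section ultrafilters.
Context {I : Type} (U : set_system I) {UU : UltraFilter U}.

Lemma ultra_fmap (T : Type) (f : I -> T) : UltraFilter (f @ U).
Proof.
split=> [|G PG UG]; first exact: fmap_proper_filter.
rewrite eqEsubset; split=> // A GA.
have [//|UA] := in_ultra_setVsetC (f @^-1` A) UU.
by have [t []] := filter_ex (filterI GA (UG (~` A) UA)).
Qed.

Lemma ultra_bit (b : I -> bool) : exists c, \forall i \near U, b i = c.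
Proof.
have [Ub|Ub] := in_ultra_setVsetC [set i | b i] UU.
  by exists true.
by exists false; apply: filterS Ub => i /= /negP/negbTE.
Qed.

End ultrafilters.

Lemma compact_ultra_cvg (T : topologicalType) (I : Type) (U : set_system I)
    (u : I -> T) :
  compact [set: T] -> UltraFilter U -> exists y : T, u @ U --> y.
Proof.
rewrite compact_ultra => Tco UU.
have [] := Tco (u @ U) (ultra_fmap u); first exact: filterT.
by move=> y [_ uy]; exists y.
Qed.

Lemma symbol_cvgP (I : Type) (F : set_system I) (FF : Filter F)
    (u : I -> symbol) (s : symbol) :
  u @ F --> s <-> (s <> Star -> \forall i \near F, u i = s).
Proof.
split=> [us ns|us].
  apply: (us [set s]); apply: open_nbhs_nbhs; split=> //.
  exists [set [set s]]; last by rewrite bigcup_set1.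
  move=> _ ->; rewrite /symbol_basis /=.
  by case: s ns {us} => //= _; [left; left | left; right].
move=> A; rewrite nbhsE => -[V [[C CB <-] [W CW Ws]] VA].
have [sS|/eqP ns] := eqVneq s Star; last first.
  by apply: filterS (us ns) => i /= ->; apply: VA; exists W.
have WT : W = setT by case: (CB W CW) Ws => [[->|->]|->]; rewrite sS.
by apply: nearW => i; apply: VA; exists W => //; rewrite WT.
Qed.

Lemma cvg_initialP (S : choiceType) (T : topologicalType) (f : S -> T)
    (F : set_system S) (FF : Filter F) (s : S) :
  F --> (s : initial_topology f) <-> f @ F --> f s.
Proof.
split=> [Fs|fFs A].
  apply: cvg_trans (cvg_app f Fs) _.
  exact: (@initial_continuous _ _ f).
rewrite nbhsE => -[V [[W oW <-] Ws] WA].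
by apply: filterS WA _; apply: fFs; apply: open_nbhs_nbhs.
Qed.

Lemma D_cvgP (tau : Lambda) (I : Type) (F : set_system I) (FF : Filter F)
    (u : I -> D tau) (y : D tau) :
  u @ F --> y <->
  forall n, set_val y n <> Star ->
    \forall i \near F, set_val (u i) n = set_val y n.
Proof.
transitivity ((set_val \o u) @ F --> (set_val y : Lambda)).
  exact: cvg_initialP.
rewrite cvg_sup; split=> [h n|h n].
  by move/cvg_initialP : (h n) => /symbol_cvgP; apply.
by apply/cvg_initialP/symbol_cvgP/h.
Qed.

(** * Continuity in the completion, compactness, dense sequences *)

Section symbolic_dynamics.
Context {tau : Lambda}.

Lemma completes_cvg (I : Type) (F : set_system I) (FF : Filter F)
    (x : I -> nat -> bool) (x0 : nat -> bool) (u : I -> D tau) (y : D tau) :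
  (forall i, completes (x i) (set_val (u i))) -> completes x0 (set_val y) ->
  (forall k, \forall i \near F, x i k = x0 k) -> u @ F --> y.
Proof.
move=> xu x0y xx0; apply/D_cvgP => n yn.
have [N yN] := completes_local (set_valP y) x0y yn.
suff xN : \forall i \near F, forall k, (k < N)%N -> x i k = x0 k.
  by apply: filterS xN => i xi; exact: yN (set_valP (u i)) (xu i).
elim: {yN} N => [|N IH]; first exact: nearW.
apply: filterS2 IH (xx0 N) => i xk xN k.
by rewrite ltnS leq_eqVlt => /predU1P[->//|]; exact: xk.
Qed.

Lemma shiftD_continuous : continuous (@shiftD tau).
Proof.
move=> y; apply/(@D_cvgP tau _ (nbhs y)) => n yn.
exact: (D_cvgP (nbhs_filter y) id y).1 n.+1 yn.
Qed.

Lemma iter_shiftDE n (x : D tau) :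
  set_val (iter n (@shiftD tau) x) = iter n shift (set_val x).
Proof. by elim: n => //= n <-. Qed.

Hypothesis htau : acceptable tau.

Definition itineraryD (x : nat -> bool) : D tau :=
  exist _ (itinerary tau x) (mem_set (itinerary_admissible htau x)).

(** Along an ultrafilter each bit of the completions is eventually constant; the itinerary of the
    limit bits is a limit. *)
Lemma D_compact : compact [set: D tau].
Proof.
rewrite compact_ultra => U UU _.
have /choice[x0 x0P] k :
    exists c, \forall y \near U, (bit \o set_val y) k = c.
  exact: ultra_bit.
exists (itineraryD x0); split=> //.
apply: (@completes_cvg _ U _ (fun y => bit \o set_val y) x0 id) => //.
  by move=> y; exact: completes_bit.
exact: completes_itinerary.
Qed.

(** For each finite binary word, [c0] picks a point of [B] with a completion starting with that
    word, if there is one; the words are enumerated by [unpickle]. *)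
Lemma dense_seq (B : set (D tau)) : B !=set0 ->
  exists c : nat -> D tau, (forall j, B (c j)) /\
    forall b, B b -> forall n, closure [set c j | j in [set j | (n <= j)%N]] b.
Proof.
move=> [b0 Bb0].
pose P (s : seq bool) (b : D tau) :=
  B b /\ exists2 x, completes x (set_val b) & mkseq x (size s) = s.
pose c0 s := if pselect (exists b, P s b) is left e then sval (cid e) else b0.
have c0P s : (exists b, P s b) -> P s (c0 s).
  by rewrite /c0; case: pselect => // e _; case: cid.
have Bc0 s : B (c0 s).
  by rewrite /c0; case: pselect => // e; case: cid => ? [].
exists (fun j => oapp c0 b0 (unpickle j)); split=> [j|b Bb n V Vb].
  by case: unpickle => [s|] //=.
pose y := bit \o set_val b.
have yP N : P (mkseq y N) (c0 (mkseq y N)).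
  apply: c0P; exists b; split=> //; exists y; first exact: completes_bit.
  by rewrite size_mkseq.
have /choice[x xP] N : exists x, completes x (set_val (c0 (mkseq y N))) /\
    mkseq x N = mkseq y N.
  by have [_ [x xc]] := yP N; rewrite size_mkseq => xy; exists x.
have : (c0 \o mkseq y) N @[N --> \oo] --> b.
  apply: (@completes_cvg _ _ _ x y).
  - by move=> N; have [] := xP N.
  - exact: completes_bit.
  - move=> k; near=> N; have [_ /(congr1 (nth false ^~ k))] := xP N.
    by rewrite !nth_mkseq //; near: N; exact: nbhs_infty_gt.
move=> /(_ V Vb)[N0 _ VN].
(* Prefixes of different lengths have different codes, so by the pigeonhole principle some code is
   at least [n]. *)
pose f k := pickle (mkseq y (N0 + k)).
have finj : injective f.
  move=> j k /(pcan_inj pickleK)/(congr1 size).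
  by rewrite !size_mkseq => /addnI.
have [k nfk] : exists k, (n <= f k)%N.
  apply: contrapT => nk.
  have fn k : (f k < n)%N by rewrite ltnNge; apply/negP => h; apply: nk; exists k.
  have /leq_card : injective (fun k : 'I_n.+1 => Ordinal (fn k)).
    by move=> j k [] /finj /val_inj.
  by rewrite !card_ord ltnn.
exists (c0 (mkseq y (N0 + k))); split.
  by exists (f k) => //; rewrite /f pickleK.
by apply: VN => /=; exact: leq_addr.
Unshelve. all: by end_near. Qed.

End symbolic_dynamics.

(** * Cluster points of sequences as ultrafilter limits *)

Section sequence_clusters.
Context {T : topologicalType} (u : nat -> T).

(** Tails and preimages of neighbourhoods of [y] generate a proper filter, which an ultrafilter
    refines. *)
Lemma ultra_cluster_seq (y : T) :
  (forall n, closure [set u k | k in [set k | (n <= k)%N]] y) ->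
  exists U, [/\ UltraFilter U, \oo `<=` U & u @ U --> y].
Proof.
move=> uy.
pose G := filter_from [set p : set T * nat | nbhs y p.1]
  (fun p => [set k | p.1 (u k) /\ (p.2 <= k)%N]).
have PG : ProperFilter G.
  apply: filter_from_proper; last first.
    by move=> [V n] /(uy n V)[_ [[k nk <-] Vk]]; exists k.
  apply: filter_from_filter; first by exists (setT, 0%N); exact: filterT.
  move=> [V n] [W m] /= yV yW; exists (V `&` W, maxn n m); first exact: filterI.
  by move=> k /= [[Vk Wk]]; rewrite geq_max => /andP[nk mk].
have [U [UU GU]] := ultraFilterLemma PG.
exists U; split=> //.
  move=> A [n _ nA]; apply: GU; exists (setT, n); first exact: filterT.
  by move=> k [_ nk]; exact: nA.
by move=> V yV; apply: GU; exists (V, 0%N) => // k [].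
Qed.

Lemma cluster_seq_ultra (U : set_system nat) (y : T) :
  ProperFilter U -> \oo `<=` U -> u @ U --> y ->
  forall n, closure [set u k | k in [set k | (n <= k)%N]] y.
Proof.
move=> PU ooU uy n V yV.
have Un : U [set k | (n <= k)%N] by exact: ooU (nbhs_infty_ge n).
have Uv : U (u @^-1` V) := uy V yV.
have [k [Vk nk]] := filter_ex (filterI Uv Un).
by exists (u k); split=> //; exists k.
Qed.

End sequence_clusters.

Lemma omega_limitP (T : topologicalType) (f : T -> T) (z y : T) :
  omega_limit f z y <-> exists U : set_system nat,
    [/\ UltraFilter U, \oo `<=` U & iter k f z @[k --> U] --> y].
Proof.
split=> [zy|[U [UU ooU zy]] n _]; last exact: (cluster_seq_ultra _ ooU zy).
by apply: ultra_cluster_seq => n; exact: zy.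
Qed.

(** * Metric limits and chain transitivity of omega-limit sets *)

Section compatible_metric.
Context {R : realType} {T : topologicalType} {d : T -> T -> R}.
Hypothesis hd : is_compatible_metric d.

Lemma metric_xx x : d x x = 0.
Proof. exact/(metric_eq0 hd). Qed.

Lemma metric_cvgP (I : Type) (F : set_system I) (FF : Filter F)
    (u : I -> T) (y : T) :
  u @ F --> y <-> forall e, 0 < e -> \forall i \near F, d y (u i) < e.
Proof.
split=> [uy e e0|uy A].
  by apply: (uy [set x | d y x < e]); rewrite (metric_nbhs hd); exists e.
rewrite (metric_nbhs hd) => -[e e0 eA].
by apply: filterS (uy e e0) => i /eA.
Qed.

Lemma metric_cvg_close (I : Type) (F : set_system I) (FF : Filter F)
    (u v : I -> T) (y : T) :
  u @ F --> y -> (forall e, 0 < e -> \forall i \near F, d (u i) (v i) < e) ->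
  v @ F --> y.
Proof.
move=> /metric_cvgP uy uv; apply/metric_cvgP => e e0.
have e20 : 0 < e / 2 by rewrite divr_gt0.
apply: filterS2 (uy _ e20) (uv _ e20) => i yu uvi.
by rewrite (le_lt_trans (metric_le_add hd y (u i) (v i)))// [e]splitr ltrD.
Qed.

Lemma metric_cvg_unique (I : Type) (F : set_system I) (FF : ProperFilter F)
    (u : I -> T) (y y' : T) :
  u @ F --> y -> u @ F --> y' -> y = y'.
Proof.
move=> /metric_cvgP uy /metric_cvgP uy'; apply/(metric_eq0 hd)/eqP.
(* Nonnegativity follows from [d y y <= d y y' + d y' y]. *)
have d_ge0 : 0 <= d y y'.
  have := metric_le_add hd y y' y; rewrite metric_xx (metric_symmetric hd y' y).
  by rewrite -mulr2n pmulrn_lge0.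
rewrite eq_le d_ge0 andbT leNgt; apply/negP => d0.
have d20 : 0 < d y y' / 2 by rewrite divr_gt0.
have [i [yi y'i]] := filter_ex (filterI (uy _ d20) (uy' _ d20)).
have := metric_le_add hd y (u i) y'.
by rewrite leNgt (metric_symmetric hd (u i)) [ltRHS]splitr ltrD.
Qed.

(* Since the orbit tail stays close to the omega-limit set together with its
   first image, an orbit segment can be pushed onto a chain in that set. *)
Lemma omega_limit_chain_transitive (f : T -> T) (z : T) :
  compact [set: T] -> continuous f ->
  internally_chain_transitive d f (omega_limit f z).
Proof.
move=> Tco fc e e0 a b za zb.
have e20 : 0 < e / 2 by rewrite divr_gt0.
pose near_by k q := d (iter k f z) q < e / 2 /\ d (f q) (iter k.+1 f z) < e / 2.
have near_cvg (U : set_system nat) (UU : Filter U) q :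
    iter k f z @[k --> U] --> q -> \forall k \near U, near_by k q.
  move=> zq.
  have fzq : f (iter k f z) @[k --> U] --> f q := cvg_comp _ _ zq (fc q).
  move: zq fzq => /metric_cvgP zq /metric_cvgP fzq.
  apply: filterS2 (zq _ e20) (fzq _ e20) => k kq fkq.
  by split=> //; rewrite metric_symmetric.
(* Otherwise the bad times are unbounded and carry an ultrafilter; by compactness the orbit
   converges along it to an omega-limit point, which is near the orbit at some bad time. *)
have [K _ KP] : \forall k \near \oo, exists2 q, omega_limit f z q & near_by k q.
  apply: contrapT => nK.
  pose S := [set k | ~ exists2 q, omega_limit f z q & near_by k q].
  have PS : ProperFilter (within S \oo).
    split; last exact: within_filter.
    rewrite /within /= => S0; apply: nK.
    by apply: filterS S0 => k; exact: contrapT.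
  have [U [UU SU]] := ultraFilterLemma PS.
  have ooU : \oo `<=` U by move=> A ooA; apply: SU; exact: cvg_within ooA.
  have [q zq] := compact_ultra_cvg (fun k => iter k f z) Tco UU.
  have Uq : U [set k | near_by k q] by exact: near_cvg.
  have US : U S by apply: SU; exact: withinT.
  have [k [qk]] := filter_ex (filterI Uq US).
  by apply; exists q => //; apply/omega_limitP; exists U.
have visit q n : omega_limit f z q -> exists2 k, (n <= k)%N & near_by k q.
  move=> /omega_limitP[U [UU ooU zq]].
  have Un : U [set k | (n <= k)%N] by exact: ooU (nbhs_infty_ge n).
  have Uq : U [set k | near_by k q] by exact: near_cvg.
  have [k [kq nk]] := filter_ex (filterI Uq Un).
  by exists k.
have [k1 Kk1 k1a] := visit a K za.
have [k2 k12 k2b] := visit b k1.+1 zb.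
have /choice[q qP] k : exists q, (K <= k)%N -> omega_limit f z q /\ near_by k q.
  have [Kk|_] := leqP K k; last by exists z.
  by have [q] := KP k Kk; exists q.
pose n := (k2 - k1)%N.
pose p i := if i == 0%N then a else if i == n then b else q (k1 + i)%N.
have n0 : (0 < n)%N by rewrite subn_gt0.
have pP i : (i <= n)%N -> omega_limit f z (p i) /\ near_by (k1 + i)%N (p i).
  rewrite /p; case: eqVneq => [->|_]; first by rewrite addn0.
  case: eqVneq => [->|_ _]; first by rewrite /n subnKC // ltnW.
  by apply: qP; rewrite (leq_trans Kk1) ?leq_addr.
exists n, p; split=> //.
- by rewrite /p gtn_eqF // eqxx.
- by move=> i /pP[].
- move=> i ni; have [_ [_ h1]] := pP i (ltnW ni).
  have [_ [h2 _]] := pP i.+1 ni; rewrite addnS in h2.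
  apply: le_lt_trans (metric_le_add hd _ (iter (k1 + i).+1 f z) _) _.
  by rewrite [e]splitr (ltrD h1 h2).
Qed.

End compatible_metric.

(** * Asymptotic pseudo-orbits and shadowing *)

(** Chains from [c j] to [c j.+1] with tolerance [1/(j+1)] are run through one after another. *)
Lemma chain_transitive_pseudo_orbit (R : realType) (T : Type) (d : T -> T -> R)
    (f : T -> T) (M : set T) (c : nat -> T) :
  internally_chain_transitive d f M -> (forall j, M (c j)) ->
  exists x : nat -> T, [/\ forall i, M (x i),
    forall e, 0 < e -> \forall i \near \oo, d (f (x i)) (x i.+1) < e
    & forall j, exists2 i, (j <= i)%N & x i = c j].
Proof.
move=> Mict Mc.
have /choice[n] j : exists n, exists p : nat -> T,
    [/\ (1 <= n)%N, p 0%N = c j, p n = c j.+1,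
        forall i, (i <= n)%N -> M (p i)
      & forall i, (i < n)%N -> d (f (p i)) (p i.+1) < j.+1%:R^-1].
  by apply: Mict => //; rewrite invr_gt0.
move=> /choice[p pP].
(* A state is a chain and a position in it. The endpoint of a chain is visited only as the start of
   the next one. *)
pose step (s : nat * nat) :=
  if (s.2.+1 < n s.1)%N then (s.1, s.2.+1) else (s.1.+1, 0%N).
pose st i := iter i step (0%N, 0%N).
have st_lt i : ((st i).2 < n (st i).1)%N.
  elim: i => [|i IH]; first by have [] := pP 0%N.
  by rewrite /= -/(st i) {1 2}/step; case: ifP => //= _; have [] := pP (st i).1.+1.
have st1_mono i j : (i <= j)%N -> ((st i).1 <= (st j).1)%N.
  move/subnK <-; elim: (j - i)%N => // k IH.
  apply: (leq_trans IH); rewrite addSn /= -/(st _) /step.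
  by case: ifP => //= _.
have st_visit j : exists2 i, (j <= i)%N & st i = (j, 0%N).
  elim: j => [|j [i ji sti]]; first by exists 0%N.
  have stk k : (k < n j)%N -> st (k + i)%N = (j, k).
    by elim: k => // k IH kn; rewrite addSn /= -/(st _) IH 1?ltnW// /step /= kn.
  have n0 : (0 < n j)%N by have [] := pP j.
  exists (n j + i)%N; first by rewrite -add1n leq_add.
  rewrite -(prednK n0) addSn /= -/(st _) stk ?prednK // /step /= prednK //.
  by rewrite ltnn.
pose x i := p (st i).1 (st i).2.
exists x; split.
- by move=> i; have [_ _ _ + _] := pP (st i).1; apply; exact: ltnW.
- move=> e e0.
  have step_lt i : d (f (x i)) (x i.+1) < (st i).1.+1%:R^-1.
    have [_ _ pn _ pd] := pP (st i).1.
    rewrite {2}/x /= -/(st i) /step; case: ltnP => /= [lt|ge]; first exact: pd.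
    have en : n (st i).1 = (st i).2.+1 by apply/eqP; rewrite eqn_leq ge st_lt.
    have [_ -> _ _ _] := pP (st i).1.+1.
    by rewrite -pn en; exact: pd.
  have [N _ Ne] : \forall j \near \oo, (j.+1%:R^-1 : R) < e.
    exact: near_infty_natSinv_lt (PosNum e0).
  have [i0 _ sti0] := st_visit N.
  exists i0 => // i /= i0i; apply: (lt_trans (step_lt i)); apply: Ne => /=.
  by rewrite -[N]/((N, 0%N).1) -sti0 st1_mono.
- move=> j; have [i ji sti] := st_visit j; exists i => //.
  by rewrite /x sti /=; have [] := pP j.
Qed.

(* A pseudo-orbit is shadowed by the point whose itinerary is made of the
   leading symbols of its entries: along an ultrafilter, x_(i+k) converges to
   sigma^k y, so the leading symbols converge to a completion of y, and a
   completion determines its point continuously. *)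
Lemma pseudo_orbit_shadow (R : realType) (tau : Lambda) (htau : acceptable tau)
    (d : D tau -> D tau -> R) (hd : is_compatible_metric d) (x : nat -> D tau) :
  (forall e, 0 < e -> \forall i \near \oo, d (shiftD (x i)) (x i.+1) < e) ->
  exists z : D tau, forall (U : set_system nat) (y : D tau),
    UltraFilter U -> \oo `<=` U ->
    iter i (@shiftD tau) z @[i --> U] --> y <-> x @ U --> y.
Proof.
move=> xd; pose w i := bit (set_val (x i) 0%N).
exists (itineraryD htau w) => U y UU ooU.
set v := fun i => iter i _ _.
have xv (y' : D tau) : x @ U --> y' -> v @ U --> y'.
  move=> xy'.
  have xk k : x (i + k)%N @[i --> U] --> iter k (@shiftD tau) y'.
    elim: k => [|k IH].
      by under eq_fun do rewrite addn0.
    under eq_fun do rewrite addnS.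
    apply: (metric_cvg_close hd _ (cvg_comp _ _ IH (@shiftD_continuous _ _))).
    move=> e e0; apply: ooU; have [N _ Ne] := xd e e0.
    by exists N => // i /= Ni; apply: Ne => /=; rewrite (leq_trans Ni) ?leq_addr.
  have /choice[w' w'P] k : exists c, \forall i \near U, w (i + k)%N = c.
    exact: ultra_bit.
  apply: (@completes_cvg _ _ _ _ (fun i k => w (k + i)%N) w').
  - move=> i; rewrite /v iter_shiftDE iter_shift_itinerary.
    exact: completes_itinerary.
  - move=> k yk; have := (D_cvgP _ _ _).1 (xk k) 0%N.
    rewrite iter_shiftDE iter_shiftE => /(_ _ yk) xky.
    have [i [xik <-]] := filter_ex (filterI xky (w'P k)).
    by rewrite /w xik bitK.
  - by move=> k; apply: filterS (w'P k) => i; rewrite addnC.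
split=> [vy|]; last exact: xv.
(* By compactness [x] has some limit along [U]; the first implication and uniqueness of limits
   identify it with [y]. *)
have [y' xy'] := compact_ultra_cvg x (D_compact htau) UU.
by rewrite (metric_cvg_unique hd _ vy (xv _ xy')).
Qed.

Unset Implicit Arguments.

Theorem theorem4p3 (R : realType) (tau : Lambda) (htau : acceptable tau)
    (d : D tau -> D tau -> R) (hd : is_compatible_metric d)
    (B : set (D tau)) (hB : B !=set0) :
  (closed B /\ internally_chain_transitive d (@shiftD tau) B) <->
  (exists z : D tau, B = omega_limit (@shiftD tau) z).
Proof.
split=> [[Bcl Bict]|[z ->]]; last first.
  split; last first.
    exact: omega_limit_chain_transitive hd _ _ (D_compact htau) shiftD_continuous.
  by apply: closed_bigI => n _; exact: closed_closure.
have [c [Bc cB]] := dense_seq hB.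
have [x [Bx xd xc]] := chain_transitive_pseudo_orbit Bict Bc.
have [z zP] := pseudo_orbit_shadow htau hd xd.
exists z; apply/seteqP; split=> [b Bb|y /omega_limitP[U [UU ooU zy]]].
  have /ultra_cluster_seq[U [UU ooU xb]] :
      forall n, closure [set x k | k in [set k | (n <= k)%N]] b.
    (* [x] takes the value [c j] at a time no earlier than [j], so it inherits the cluster points of
       [c]. *)
    move=> n V bV; have [_ [[j nj <-] Vj]] := cB b Bb n V bV.
    have [i ji xi] := xc j; exists (x i); split; last by rewrite xi.
    by exists i => //=; exact: leq_trans ji.
  by apply/omega_limitP; exists U; split=> //; exact/zP.
have xy := (zP U y UU ooU).1 zy.
apply: Bcl => V yV.
have [k Vk] := @filter_ex _ U _ _ (xy V yV).
by exists (x k).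
Qed.
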